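(* Let $\mathcal S$ and $\mathcal T$ be operator systems and let $J$ be a kernel in $\mathcal S$. If $\varphi:\mathcal S\to\mathcal T$ is a unital completely positive map with $J\subseteq\ker(\varphi)$, then the map $\tilde\varphi:\mathcal S/J\to\mathcal T$ given by $\tilde\varphi(x+J)=\varphi(x)$ is unital and completely positive. Moreover, if $\mathcal R$ is an operator system and $\psi:\mathcal S\to\mathcal R$ is a unital completely positive map, with the property that whenever $\mathcal T$ is an operator system and $\varphi:\mathcal S\to\mathcal T$ is a unital completely positive map with $J\subseteq\ker(\varphi)$, there exists a unique unital completely positive map $\hat\varphi:\mathcal R\to\mathcal T$ such that $\hat\varphi\circ\psi=\varphi$, then there exists a complete order isomorphism $\gamma:\mathcal R\to\mathcal S/J$ such that $\gamma\circ\psi=q$, where $q:\mathcal S\to\mathcal S/J$ is the quotient map.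
   Context: Operator system: a selfadjoint subspace of some $\mathcal B(H)$ containing the identity (equivalently, an abstract Choi–Effros operator system); $M_n(\mathcal S)^+$ denotes the cone of positive elements of $M_n(\mathcal S)$. A kernel in $\mathcal S$ is a subspace $J\subseteq\mathcal S$ for which there exist an operator system $\mathcal T$ and a unital completely positive map $\phi:\mathcal S\to\mathcal T$ with $J=\ker\phi$. The quotient operator system $\mathcal S/J$ has matrix cones $C_n(\mathcal S/J)=\{(x_{ij}+J)\in M_n(\mathcal S/J):\forall\epsilon>0\ \exists k_{ij}\in J\text{ with }\epsilon 1\otimes I_n+(x_{ij}+k_{ij})\in M_n(\mathcal S)^+\}$ and Archimedean matrix order unit $1+J$. A complete order isomorphism is an invertible linear map that is completely positive and has completely positive inverse.
   Formalization: In the second part the formal statement also assumes $J\subseteq\ker(\psi)$; without it the claim fails for $\mathcal R=\mathcal S$, $\psi=\mathrm{id}$ and any nonzero kernel $J$. *)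

(* Defs.v *)
From HB Require Import structures.
From mathcomp Require Import all_boot all_order all_algebra.
From mathcomp Require Import boolp classical_sets reals.
From mathcomp Require Export complex.
From mathcomp Require Import ring.

Set Implicit Arguments.
Unset Strict Implicit.
Unset Printing Implicit Defensive.

Import Order.TTheory GRing.Theory Num.Theory.

Local Open Scope ring_scope.
Local Open Scope complex_scope.
Local Open Scope classical_set_scope.

(* Abstract (Choi-Effros) operator systems over the complex field [R[i]],
   where [R] is the field of real numbers. *)

HB.mixin Record isStarSpace (R : realType) V of GRing.Lmodule R[i] V := {
  adj : V -> V;
  adjK : involutive adj;
  adjD : {morph adj : x y / x + y};
  adjZ : forall (a : R[i]) x, adj (a *: x) = a^*%C *: adj x
}.

#[short(type="starSpaceType")]
HB.structure Definition StarSpace (R : realType) :=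
  { V of isStarSpace R V & GRing.Lmodule R[i] V }.

Section MatrixOperations.
Variable R : realType.

Definition mxadj (V : starSpaceType R) n (X : 'M[V]_n) : 'M[V]_n :=
  map_mx adj X^T.

(* [A^* X A], for a scalar matrix [A] and a matrix [X] of vectors. *)
Definition mxcongr (V : lmodType R[i]) n m (A : 'M[R[i]]_(n, m))
    (X : 'M[V]_n) : 'M[V]_m :=
  \matrix_(i, j) \sum_k \sum_l ((A k i)^*%C * A l j) *: X k l.

(* [r (e \otimes I_n)]. *)
Definition mxunit (V : lmodType R[i]) (e : V) n (r : R) : 'M[V]_n :=
  \matrix_(i, j) ((r%:C *: e) *+ (i == j)).

Definition mxscale (V : lmodType R[i]) n (a : R[i]) (X : 'M[V]_n) : 'M[V]_n :=
  map_mx ( *:%R a) X.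

End MatrixOperations.

(* The size [n = 0] is allowed for uniformity: the axioms force
   [poscone 0] to be the whole (one-point) space ['M_0]. The zero space,
   i.e. operators on the zero Hilbert space, is not excluded. *)
HB.mixin Record isOperatorSystem (R : realType) V of StarSpace R V := {
  osunit : V;
  adj_osunit : adj osunit = osunit;
  poscone : forall n, set 'M[V]_n;
  poscone_adj : forall n (X : 'M[V]_n), poscone n X -> mxadj X = X;
  posconeD : forall n (X Y : 'M[V]_n),
    poscone n X -> poscone n Y -> poscone n (X + Y);
  posconeZ : forall n (r : R) (X : 'M[V]_n),
    0 <= r -> poscone n X -> poscone n (mxscale r%:C X);
  poscone_proper : forall n (X : 'M[V]_n),
    poscone n X -> poscone n (- X) -> X = 0;
  poscone_congr : forall n m (A : 'M[R[i]]_(n, m)) (X : 'M[V]_n),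
    poscone n X -> poscone m (mxcongr A X);
  osunit_order : forall n (X : 'M[V]_n), mxadj X = X ->
    exists2 r : R, 0 < r & poscone n (mxunit osunit n r - X);
  osunit_archi : forall n (X : 'M[V]_n),
    (forall r : R, 0 < r -> poscone n (mxunit osunit n r + X)) ->
    poscone n X
}.

#[short(type="opSystemType")]
HB.structure Definition OperatorSystem (R : realType) :=
  { V of isOperatorSystem R V & StarSpace R V }.

Arguments osunit {R s}.
Arguments poscone {R s} n.
Arguments poscone_adj {R s n X}.
Arguments posconeD {R s n X Y}.
Arguments posconeZ {R s n r X}.
Arguments poscone_proper {R s n X}.
Arguments poscone_congr {R s n m} A {X}.
Arguments osunit_order {R s n X}.
Arguments osunit_archi {R s n X}.

Section Maps.
Variables (R : realType) (S T : opSystemType R).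

Definition completely_positive (f : S -> T) : Prop :=
  linear f /\
  forall n (X : 'M[S]_n), poscone n X -> poscone n (map_mx f X).

Definition ucp (f : S -> T) : Prop :=
  completely_positive f /\ f osunit = osunit.

Definition null_space (f : S -> T) : set S := [set x | f x = 0].

End Maps.

Definition complete_order_iso (R : realType) (S T : opSystemType R)
    (f : S -> T) : Prop :=
  exists g : T -> S, [/\ cancel f g, cancel g f,
    completely_positive f & completely_positive g].

Definition is_kernel (R : realType) (S : opSystemType R) (J : set S) : Prop :=
  exists (T : opSystemType R) (f : S -> T), ucp f /\ J = null_space f.

Record opkernel (R : realType) (S : opSystemType R) := OpKernel {
  opkernel_set :> set S;
  opkernelP : is_kernel opkernel_set
}.

Section MatrixLemmas.
Variables (R : realType).

Lemma map_mxunit (V W : lmodType R[i]) (f : {linear V -> W}) (e : V) n r :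
  map_mx f (mxunit e n r) = mxunit (f e) n r.
Proof. by apply/matrixP => i j; rewrite !mxE raddfMn /= linearZ. Qed.

Lemma map_mxcongr (V W : lmodType R[i]) (f : {linear V -> W}) n m
    (A : 'M[R[i]]_(n, m)) (X : 'M[V]_n) :
  map_mx f (mxcongr A X) = mxcongr A (map_mx f X).
Proof.
apply/matrixP => i j; rewrite !mxE raddf_sum; apply: eq_bigr => k _.
by rewrite raddf_sum; apply: eq_bigr => l _; rewrite !mxE /= linearZ.
Qed.

Lemma map_mxscale (V W : lmodType R[i]) (f : {linear V -> W}) n a
    (X : 'M[V]_n) :
  map_mx f (mxscale a X) = mxscale a (map_mx f X).
Proof. by apply/matrixP => i j; rewrite !mxE /= linearZ. Qed.

Lemma mxunitD (V : lmodType R[i]) (e : V) n r s :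
  mxunit e n (r + s) = mxunit e n r + mxunit e n s.
Proof. by apply/matrixP => i j; rewrite !mxE rmorphD scalerDl mulrnDl. Qed.

Lemma mxscale_unit (V : lmodType R[i]) (e : V) n r s :
  mxscale r%:C (mxunit e n s) = mxunit e n (r * s).
Proof. by apply/matrixP => i j; rewrite !mxE -scalerMnr scalerA -rmorphM. Qed.

Lemma mxscaleD (V : lmodType R[i]) n a (X Y : 'M[V]_n) :
  mxscale a (X + Y) = mxscale a X + mxscale a Y.
Proof. by apply/matrixP => i j; rewrite !mxE scalerDr. Qed.

Lemma mxscale0 (V : lmodType R[i]) n (X : 'M[V]_n) : mxscale 0 X = 0.
Proof. by apply/matrixP => i j; rewrite !mxE scale0r. Qed.

Lemma mxcongrD (V : lmodType R[i]) n m (A : 'M[R[i]]_(n, m)) (X Y : 'M[V]_n) :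
  mxcongr A (X + Y) = mxcongr A X + mxcongr A Y.
Proof.
apply/matrixP => i j; rewrite !mxE -big_split; apply: eq_bigr => k _ /=.
by rewrite -big_split; apply: eq_bigr => l _; rewrite !mxE scalerDr.
Qed.

End MatrixLemmas.

Section StarLemmas.
Variables (R : realType) (V : starSpaceType R).

Lemma adj_scale_real (r : R) (x : V) : adj (r%:C *: x) = r%:C *: adj x.
Proof. by rewrite adjZ /= oppr0. Qed.

Lemma adj0 : adj (0 : V) = 0.
Proof. by apply: (addIr (adj 0)); rewrite -adjD !add0r. Qed.

Lemma adjN (x : V) : adj (- x) = - adj x.
Proof.
by apply/eqP; rewrite -subr_eq0 opprK -adjD addNr adj0.
Qed.

Lemma adjB (x y : V) : adj (x - y) = adj x - adj y.
Proof. by rewrite adjD adjN. Qed.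

Lemma adj_cartesian (x : V) : exists h k : V,
  [/\ adj h = h, adj k = k & x = h + 'i%C *: k].
Proof.
exists ((2^-1)%:C *: (x + adj x)), ((2^-1)%:C *: ((- 'i%C) *: (x - adj x))).
have half : (2^-1)%:C + (2^-1)%:C = 1 :> R[i].
  by rewrite -rmorphD -div1r -splitr.
split.
- by rewrite adj_scale_real adjD adjK addrC.
- rewrite adj_scale_real adjZ adjB adjK; congr (_ *: _).
  have -> : (- 'i%C)^*%C = 'i%C :> R[i] by simpc.
  by rewrite scaleNr -scalerN opprB.
- rewrite [in RHS]scalerA mulrC -scalerA -scalerDr (scalerA 'i%C).
  have -> : 'i%C * - 'i%C = 1 :> R[i] by simpc.
  by rewrite scale1r addrACA subrr addr0 -mulr2n -scalerMnr mulr2n -scalerDl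
    half scale1r.
Qed.

End StarLemmas.

Section UcpLemmas.
Variables (R : realType) (S T : opSystemType R).

Lemma ucp_adj (f : S -> T) : ucp f -> forall x, f (adj x) = adj (f x).
Proof.
move=> [[flin fpos] f1].
pose F : {linear S -> T} := HB.pack f (GRing.isLinear.Build _ _ _ _ f flin).
have fD x y : f (x + y) = f x + f y := linearD F x y.
have fB x y : f (x - y) = f x - f y := linearB F x y.
have fZ a x : f (a *: x) = a *: f x := linearZ_LR F a x.
have sa (x : S) : adj x = x -> adj (f x) = f x.
  move=> xsa; pose X : 'M[S]_1 := const_mx x.
  have /osunit_order[r _ /fpos /poscone_adj] : mxadj X = X.
    by apply/matrixP => i j; rewrite !mxE.
  move=> /matrixP/(_ 0 0); rewrite !mxE /=.
  rewrite !mulr1n fB fZ f1 adjB adj_scale_real adj_osunit.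
  by move=> /addrI/oppr_inj.
move=> x; have [h [k [hsa ksa ->]]] := adj_cartesian x.
by rewrite adjD adjZ hsa ksa !fD !fZ adjD adjZ !sa.
Qed.

End UcpLemmas.

Section Quotient.
Variables (R : realType) (S : opSystemType R) (J : opkernel S).
Local Notation inJ := (opkernel_set J).

(* Boolean membership, as required by the library's quotient by a subgroup. *)
Definition opkernel_pred : {pred S} := fun x => `[< inJ x >].

Lemma opkernelE x : (x \in opkernel_pred) <-> inJ x.
Proof. by split=> /asboolP. Qed.

Lemma opkernel_morph : exists (T : opSystemType R) (f : {linear S -> T}),
  [/\ ucp f, forall x, inJ x <-> f x = 0 & forall x, f (adj x) = adj (f x)].
Proof.
have [T [f [fucp JE]]] := opkernelP J.
pose F : {linear S -> T} :=
  HB.pack f (GRing.isLinear.Build _ _ _ _ f fucp.1.1).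
by exists T, F; split=> // x; [rewrite JE | exact: ucp_adj].
Qed.

Lemma opkernel_zmod_closed : zmod_closed opkernel_pred.
Proof.
have [T [f [_ JE _]]] := opkernel_morph.
split=> [|x y]; rewrite -!topredE /=; first by apply/opkernelE/JE/linear0.
move=> /opkernelE/JE fx /opkernelE/JE fy.
by apply/opkernelE/JE; rewrite linearB fx fy subr0.
Qed.

HB.instance Definition _ :=
  GRing.isZmodClosed.Build S opkernel_pred opkernel_zmod_closed.

Definition opquot : Type := Quotient.quot opkernel_pred.

HB.instance Definition _ := GRing.Zmodule.on opquot.

Definition quot_map (x : S) : opquot := (\pi_(Quotient.quot opkernel_pred) x)%qT.

Definition quot_repr (y : opquot) : S := repr y.

Lemma quot_reprK : cancel quot_repr quot_map.
Proof. exact: reprK. Qed.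

Lemma quot_mapP x y : quot_map x = quot_map y <-> inJ (x - y).
Proof.
by rewrite -opkernelE Quotient.idealrBE; split=> [|/eqP] => [/eqP|].
Qed.

Lemma quot_map_zmod : zmod_morphism quot_map.
Proof. exact: pi_is_zmod_morphism. Qed.

Lemma opkernelZ a x : inJ x -> inJ (a *: x).
Proof.
have [T [f [_ JE _]]] := opkernel_morph.
by move=> /JE fx; apply/JE; rewrite linearZ /= fx scaler0.
Qed.

Lemma opkernel_adj x : inJ x -> inJ (adj x).
Proof.
have [T [f [_ JE fadj]]] := opkernel_morph.
by move=> /JE fx; apply/JE; rewrite fadj fx adj0.
Qed.

Definition quot_scale (a : R[i]) (y : opquot) : opquot :=
  quot_map (a *: quot_repr y).

Lemma quot_scaleE a x : quot_scale a (quot_map x) = quot_map (a *: x).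
Proof.
apply/quot_mapP; rewrite -scalerBr; apply/opkernelZ/quot_mapP.
exact: quot_reprK.
Qed.

Let qD : {morph quot_map : x y / x + y}.
Proof.
pose F : {additive S -> opquot} :=
  HB.pack quot_map (GRing.isZmodMorphism.Build _ _ quot_map quot_map_zmod).
exact: (raddfD F).
Qed.

Lemma quot_scaleA a b y : quot_scale a (quot_scale b y) = quot_scale (a * b) y.
Proof. by rewrite -(quot_reprK y) !quot_scaleE scalerA. Qed.

Lemma quot_scale1 : left_id 1 quot_scale.
Proof. by move=> y; rewrite -(quot_reprK y) !quot_scaleE scale1r. Qed.

Lemma quot_scaleDr : right_distributive quot_scale +%R.
Proof.
move=> a x y; rewrite -(quot_reprK x) -(quot_reprK y).
by rewrite -qD !quot_scaleE -qD scalerDr.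
Qed.

Lemma quot_scaleDl y : {morph quot_scale^~ y : a b / a + b}.
Proof.
by move=> a b; rewrite -(quot_reprK y) !quot_scaleE -qD scalerDl.
Qed.

HB.instance Definition _ := GRing.Zmodule_isLmodule.Build R[i] opquot
  quot_scaleA quot_scale1 quot_scaleDr quot_scaleDl.

Lemma quot_map_linear : linear quot_map.
Proof. by move=> a x y; rewrite qD -quot_scaleE. Qed.

HB.instance Definition _ :=
  GRing.isLinear.Build R[i] S opquot *:%R quot_map quot_map_linear.

Definition quot_adj (y : opquot) : opquot := quot_map (adj (quot_repr y)).

Lemma quot_adjE x : quot_adj (quot_map x) = quot_map (adj x).
Proof.
apply/quot_mapP; rewrite -adjB; apply/opkernel_adj/quot_mapP.
exact: quot_reprK.
Qed.

Lemma quot_adjK : involutive quot_adj.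
Proof. by move=> y; rewrite -(quot_reprK y) !quot_adjE adjK. Qed.

Lemma quot_adjD : {morph quot_adj : x y / x + y}.
Proof.
move=> x y; rewrite -(quot_reprK x) -(quot_reprK y).
by rewrite -qD !quot_adjE -qD adjD.
Qed.

Lemma quot_adjZ (a : R[i]) y : quot_adj (a *: y) = a^*%C *: quot_adj y.
Proof.
by rewrite -(quot_reprK y) -linearZ !quot_adjE adjZ linearZ.
Qed.

HB.instance Definition _ := isStarSpace.Build R opquot
  quot_adjK quot_adjD quot_adjZ.

Definition quot_unit : opquot := quot_map osunit.

Definition quot_cone n : set 'M[opquot]_n :=
  [set Y | exists2 X : 'M[S]_n, Y = map_mx quot_map X &
     forall e : R, 0 < e -> exists2 K : 'M[S]_n, (forall i j, inJ (K i j)) &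
       poscone n (mxunit osunit n e + (X + K))].

Lemma mx_reprK n (Y : 'M[opquot]_n) : map_mx quot_map (map_mx quot_repr Y) = Y.
Proof. by apply/matrixP => i j; rewrite !mxE quot_reprK. Qed.

Lemma mx_quotP n (X X' : 'M[S]_n) :
  map_mx quot_map X = map_mx quot_map X' <-> forall i j, inJ ((X - X') i j).
Proof.
split=> [/matrixP XX' i j|XX']; last apply/matrixP => i j.
  by have := XX' i j; rewrite !mxE => /quot_mapP.
by have := XX' i j; rewrite !mxE => /quot_mapP.
Qed.

Lemma map_mxadj n (X : 'M[S]_n) :
  map_mx quot_map (mxadj X) = mxadj (map_mx quot_map X).
Proof. by apply/matrixP => i j; rewrite !mxE /= -quot_adjE. Qed.

Lemma quot_kerD n (K : 'M[S]_n) : (forall i j, inJ (K i j)) ->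
  map_mx quot_map K = 0.
Proof.
move=> JK; rewrite -(map_mx0 quot_map); apply/mx_quotP => i j.
by rewrite subr0.
Qed.

Lemma quot_adj_unit : adj quot_unit = quot_unit.
Proof. by rewrite [LHS]quot_adjE adj_osunit. Qed.

Lemma mxunit_sa (V : starSpaceType R) (e : V) n r :
  adj e = e -> mxadj (mxunit e n r) = mxunit e n r.
Proof.
move=> esa; apply/matrixP => i j; rewrite !mxE eq_sym.
by case: (i == j); rewrite ?mulr1n ?mulr0n ?adj0 // adj_scale_real esa.
Qed.

Lemma mxadjD (V : starSpaceType R) n (X Y : 'M[V]_n) :
  mxadj (X + Y) = mxadj X + mxadj Y.
Proof. by apply/matrixP => i j; rewrite !mxE adjD. Qed.

Lemma quot_cone_adj n (Y : 'M[opquot]_n) : quot_cone Y -> mxadj Y = Y.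
Proof.
move=> [X -> /(_ 1 ltr01)[K JK /poscone_adj]].
rewrite mxadjD mxunit_sa ?adj_osunit// => /addrI sa.
have := congr1 (map_mx quot_map) sa.
by rewrite map_mxadj !map_mxD (quot_kerD JK) !addr0.
Qed.

Lemma quot_coneD n (X Y : 'M[opquot]_n) :
  quot_cone X -> quot_cone Y -> quot_cone (X + Y).
Proof.
move=> [X' -> HX] [Y' -> HY]; exists (X' + Y'); first by rewrite map_mxD.
move=> e e0; have e20 : 0 < e / 2 by rewrite divr_gt0.
have [K JK HK] := HX _ e20; have [L JL HL] := HY _ e20.
exists (K + L); first last.
  rewrite [in mxunit _ _ _](splitr e) mxunitD (addrACA X').
  rewrite (addrACA (mxunit _ _ _)).
  exact: posconeD.
move=> i j; rewrite mxE; have [T [f [_ JE _]]] := opkernel_morph.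
by apply/JE; rewrite linearD (JE _).1 // (JE _).1 // addr0.
Qed.

Lemma poscone_unit n (r : R) : 0 <= r ->
  poscone n (mxunit (osunit : S) n r).
Proof.
move=> r0; have [|s s0] := @osunit_order R S n 0.
  by apply/matrixP => i j; rewrite !mxE adj0.
rewrite subr0 => /(posconeZ (divr_ge0 r0 (ltW s0))).
by rewrite mxscale_unit divfK // gt_eqF.
Qed.

Lemma quot_coneZ n (r : R) (Y : 'M[opquot]_n) :
  0 <= r -> quot_cone Y -> quot_cone (mxscale r%:C Y).
Proof.
rewrite le_eqVlt => /predU1P[<- _|r0 [X -> HX]].
  exists 0; first by rewrite mxscale0 map_mx0.
  move=> e e0; exists 0 => [i j|].
    by rewrite mxE; apply/opkernelE/rpred0.
  by rewrite !addr0; exact/poscone_unit/ltW.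
exists (mxscale r%:C X); first by rewrite map_mxscale.
move=> e e0; have [K JK HK] := HX _ (divr_gt0 e0 r0).
exists (mxscale r%:C K); first by move=> i j; rewrite mxE; exact: opkernelZ.
have := posconeZ (ltW r0) HK.
by rewrite !mxscaleD mxscale_unit mulrCA divff ?gt_eqF// mulr1.
Qed.

Lemma quot_cone_morph (T : opSystemType R) (f : {linear S -> T}) :
    ucp f -> (forall x, inJ x -> f x = 0) ->
  forall n (X : 'M[S]_n), quot_cone (map_mx quot_map X) ->
    poscone n (map_mx f X).
Proof.
move=> [[_ fpos] f1] Jf n X [X' /mx_quotP XX' HX].
have -> : map_mx f X = map_mx f X'.
  apply/matrixP => i j; rewrite !mxE; apply/eqP.
  by rewrite -subr_eq0 -linearB; apply/eqP/Jf; have := XX' i j; rewrite !mxE.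
apply: osunit_archi => r r0; have [K JK /fpos] := HX _ r0.
rewrite !map_mxD map_mxunit /= f1.
have -> : map_mx f K = 0; last by rewrite addr0.
by apply/matrixP => i j; rewrite !mxE; exact: Jf.
Qed.

Lemma quot_cone_proper n (Y : 'M[opquot]_n) :
  quot_cone Y -> quot_cone (- Y) -> Y = 0.
Proof.
have [T [f [fucp JE _]]] := opkernel_morph.
have Jf x : inJ x -> f x = 0 by move/JE.
rewrite -(mx_reprK Y); set X := map_mx quot_repr Y.
rewrite -map_mxN => /(quot_cone_morph fucp Jf) p.
move=> /(quot_cone_morph fucp Jf); rewrite map_mxN => /(poscone_proper p) fX0.
apply: quot_kerD => i j; apply/JE.
by have /matrixP/(_ i j) := fX0; rewrite !mxE.
Qed.

Lemma mxcongr_sa (V : starSpaceType R) n m (A : 'M[R[i]]_(n, m))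
    (X : 'M[V]_n) :
  mxadj X = X -> mxadj (mxcongr A X) = mxcongr A X.
Proof.
move=> saX; apply/matrixP => i j; rewrite !mxE.
have adj_sum (I : finType) (F : I -> V) : adj (\sum_k F k) = \sum_k adj (F k).
  by apply: (big_morph adj (@adjD _ _)); rewrite adj0.
rewrite adj_sum exchange_big; apply: eq_bigr => k _ /=.
rewrite adj_sum; apply: eq_bigr => l _.
have -> : adj (((A k j)^*%C * A l i) *: X k l) =
    ((A l i)^*%C * A k j) *: adj (X k l).
  rewrite adjZ; congr (_ *: _).
  by case: (A k j) (A l i) => [a b] [c d]; simpc; congr (_ +i* _); ring.
by have /matrixP/(_ l k) := saX; rewrite !mxE => ->.
Qed.

Lemma quot_cone_congr n m (A : 'M[R[i]]_(n, m)) (Y : 'M[opquot]_n) :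
  quot_cone Y -> quot_cone (mxcongr A Y).
Proof.
move=> [X -> HX]; exists (mxcongr A X); first by rewrite map_mxcongr.
have [|s s0 Hs] := @osunit_order R S m (mxcongr A (mxunit osunit n 1)).
  by apply/mxcongr_sa/mxunit_sa/adj_osunit.
move=> e e0; have es0 : 0 < e / s by rewrite divr_gt0.
have [K JK HK] := HX _ es0; exists (mxcongr A K).
  move=> i j; have [T [f [_ JE _]]] := opkernel_morph; apply/JE.
  rewrite mxE linear_sum big1 // => k _; rewrite linear_sum big1 // => l _.
  by rewrite linearZ /= (JE _).1 // scaler0.
have := posconeD (posconeZ (ltW es0) Hs) (poscone_congr A HK).
rewrite !mxcongrD mxscaleD mxscale_unit divfK ?gt_eqF//.
set c := mxscale _ (- _); set d := mxcongr _ (mxunit _ _ _).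
have -> : c = - d.
  apply/matrixP => i j; rewrite !mxE scalerN scaler_sumr; congr (- _).
  apply: eq_bigr => k _; rewrite scaler_sumr; apply: eq_bigr => l _.
  rewrite !mxE scalerA (mulrC (e / s)%:C) -[LHS]scalerA; congr (_ *: _).
  by rewrite -scalerMnr scalerA -rmorphM mulr1.
by rewrite -addrA addKr.
Qed.

Lemma quot_unit_order n (Y : 'M[opquot]_n) : mxadj Y = Y ->
  exists2 r : R, 0 < r & quot_cone (mxunit quot_unit n r - Y).
Proof.
rewrite -(mx_reprK Y); set X := map_mx quot_repr Y => saY.
pose Z := mxscale (2^-1)%:C (X + mxadj X).
have [|r r0 Hr] := @osunit_order R S n Z.
  apply/matrixP => i j.
  by rewrite !mxE adj_scale_real adjD adjK addrC.
exists r => //; exists (mxunit osunit n r - Z).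
  rewrite map_mxB map_mxunit map_mxscale map_mxD map_mxadj saY.
  congr (_ - _); apply/matrixP => i j; rewrite !mxE.
  by rewrite scalerDr -scalerDl -rmorphD -div1r -splitr scale1r.
move=> e e0; exists 0 => [i j|].
  by rewrite mxE; apply/opkernelE/rpred0.
by rewrite addr0; apply: posconeD Hr; exact/poscone_unit/ltW.
Qed.

Lemma quot_unit_archi n (Y : 'M[opquot]_n) :
  (forall r : R, 0 < r -> quot_cone (mxunit quot_unit n r + Y)) ->
  quot_cone Y.
Proof.
rewrite -(mx_reprK Y); set X := map_mx quot_repr Y => HY.
exists X => // e e0; have e20 : 0 < e / 2 by rewrite divr_gt0.
have [X' XE /(_ _ e20)[K JK HK]] := HY _ e20.
exists (X' - (mxunit osunit n (e / 2) + X) + K).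
  move=> i j; have [T [f [_ JE _]]] := opkernel_morph; apply/JE.
  rewrite mxE linearD /= [f (K i j)](JE _).1 // addr0; apply/JE.
  apply: (mx_quotP _ _).1; rewrite -XE map_mxD map_mxunit.
  by [].
rewrite [in mxunit _ _ e](splitr e) mxunitD -addrA; set U := mxunit _ _ _ in HK *.
by rewrite (addrA U X) (addrA (U + X)) (addrC (U + X)) subrK.
Qed.

HB.instance Definition _ := isOperatorSystem.Build R opquot
  quot_adj_unit quot_cone_adj quot_coneD quot_coneZ quot_cone_proper
  quot_cone_congr quot_unit_order quot_unit_archi.

End Quotient.

(* Main.v *)
(* A positive class over [S/J] is, for every [e > 0], the image of an element
   of [S] that becomes positive after adding [e] times the unit and an element
   of [J]; applying [phi] kills the latter, and the Archimedean property of the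
   target removes [e].  In the second part the factorizations of [q] through
   [psi] and of [psi] through [q] are mutually inverse: one composite is the
   identity by the uniqueness clause, the other because [q] is onto. *)
Require Import Defs.
From HB Require Import structures.
From mathcomp Require Import all_boot all_order all_algebra.
From mathcomp Require Import boolp classical_sets reals.

Import Order.TTheory GRing.Theory.

Local Open Scope classical_set_scope.

Lemma ucp_id {K : realType} (S : opSystemType K) : ucp (fun x : S => x).
Proof.
split=> //; split=> [a x y //|n X].
by have -> : map_mx (fun x : S => x) X = X by apply/matrixP => i j; rewrite mxE.
Qed.

Lemma ucp_comp {K : realType} {S T U : opSystemType K} {f : S -> T}
    {g : T -> U} : ucp f -> ucp g -> ucp (g \o f).
Proof.
move=> [[flin fpos] f1] [[glin gpos] g1]; split; last by rewrite /= f1.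
split=> [a x y|n X /fpos/gpos]; first by rewrite /= flin glin.
by rewrite -map_mx_comp.
Qed.

Lemma ucp_quot_map {K : realType} {S : opSystemType K} (J : opkernel S) :
  ucp (quot_map J).
Proof.
split=> //; split=> [|n X X0]; first exact: quot_map_linear.
exists X => // e e0; exists 0%R => [i j|].
  by rewrite mxE; apply/opkernelE/rpred0.
by rewrite addr0; apply: posconeD X0; exact/poscone_unit/ltW.
Qed.

Lemma quot_map_null {K : realType} {S : opSystemType K} (J : opkernel S) :
  J `<=` null_space (quot_map J).
Proof.
move=> x Jx; rewrite /null_space /= -(linear0 (quot_map J)).
by apply/quot_mapP; rewrite subr0.
Qed.

(** Evaluating [phi] at a chosen representative does not depend on the choice, because [phi] kills
    [J]. *)
Lemma ucp_quot_factor {K : realType} {S T : opSystemType K} {J : opkernel S}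
    {phi : S -> T} : ucp phi -> J `<=` null_space phi ->
  exists2 tphi : opquot J -> T,
    (forall x : S, tphi (quot_map J x) = phi x) & ucp tphi.
Proof.
move=> phiucp Jphi.
pose F : {linear S -> T} :=
  HB.pack phi (GRing.isLinear.Build _ _ _ _ phi phiucp.1.1).
have tphiE x : phi (quot_repr (quot_map J x)) = phi x.
  apply/eqP; rewrite -subr_eq0 -(linearB F); apply/eqP/Jphi.
  by apply/quot_mapP; rewrite quot_reprK.
exists (phi \o @quot_repr _ _ J) => //; split; last by rewrite /= tphiE phiucp.2.
split=> [a x y|n Y Y0].
  rewrite -(quot_reprK x) -(quot_reprK y) -quot_map_linear /= !tphiE.
  exact: phiucp.1.1.
(* Positivity transfers along the lift of [Y] by entrywise representatives. *)
rewrite map_mx_comp; apply: (quot_cone_morph (f := F) phiucp Jphi).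
by rewrite mx_reprK.
Qed.

(** Requiring [psi] to kill [J] rules out [psi = id] on [S], which has the factorization property
    for every [J] although [quot_map J] is injective only when [J] is zero. *)
Theorem proposition3p6 (K : realType) (S : opSystemType K) (J : opkernel S) :
  (forall (T : opSystemType K) (phi : S -> T),
     ucp phi -> J `<=` null_space phi ->
     exists2 tphi : opquot J -> T,
       (forall x : S, tphi (quot_map J x) = phi x) & ucp tphi)
  /\
  (forall (R : opSystemType K) (psi : S -> R),
     ucp psi -> J `<=` null_space psi ->
     (forall (T : opSystemType K) (phi : S -> T),
        ucp phi -> J `<=` null_space phi ->
        exists! hphi : R -> T, ucp hphi /\ hphi \o psi = phi) ->
     exists2 gamma : R -> opquot J,
       complete_order_iso gamma & gamma \o psi = quot_map J).
Proof.
split=> [T phi|R psi psiucp Jpsi univ]; first exact: ucp_quot_factor.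
have [gamma [[gucp gpsi] _]] :=
  univ _ _ (ucp_quot_map J) (quot_map_null J).
have [tpsi tpsiE tucp] := ucp_quot_factor psiucp Jpsi.
exists gamma => //; exists tpsi; split=> [r|y||]; last exact: tucp.1; last exact: gucp.1.
(* Taking [phi := psi], both [id] and [tpsi \o gamma] factor [psi] through itself, so they agree. *)
- have [h [_ huniq]] := univ _ _ psiucp Jpsi.
  have hid : h = id by apply: huniq; split; first exact: ucp_id.
  have hcomp : h = tpsi \o gamma.
    apply: huniq; split; first exact: ucp_comp.
    by rewrite -compA gpsi; apply/funext => x /=.
  by rewrite -[RHS]/(id r) -hid hcomp.
- by rewrite -(quot_reprK y) tpsiE -[LHS]/((gamma \o psi) _) gpsi.
Qed.
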